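(* For every $\alpha,\beta\in(0,1)$ with $\alpha+\beta<1$ there exists a function $f_0\in C(G_{\mathbf m}^2)$ for which $$\omega\Big(f_0,\frac1{M_n}\Big)_C=O\Big(\Big(\frac1{M_n}\Big)^{\alpha+\beta}\Big)\quad (n\to\infty)$$ and $$\limsup_{n\to\infty}\left\Vert\sigma_{M_n,M_n}^{-\alpha,-\beta}(f_0)-f_0\right\Vert_1>0.$$
   Context: Vilenkin group: $\mathbf m=(m_0,m_1,\dots)$ is a fixed bounded sequence of integers $m_k\ge 2$. $G_{\mathbf m}=\prod_{k\ge0}\mathbb Z/m_k\mathbb Z$ is the compact product group (discrete topology on each factor, coordinatewise addition modulo $m_k$), with elements $x=(x_0,x_1,\dots)$, $x_k\in\{0,\dots,m_k-1\}$, and $\mu$ is its normalized Haar measure; the normalized Haar measure on $G_{\mathbf m}^2=G_{\mathbf m}\times G_{\mathbf m}$ is also denoted $\mu$. Put $I_0=G_{\mathbf m}$ and $I_n=\{x\in G_{\mathbf m}:x_0=\dots=x_{n-1}=0\}$ for $n\ge1$. Put $M_0=1$, $M_{k+1}=m_kM_k$. Each integer $n\ge 0$ is uniquely $n=\sum_{j\ge0}n_jM_j$ with $n_j\in\{0,\dots,m_j-1\}$, finitely many nonzero. Vilenkin system: $r_k(x)=\exp(2\pi i x_k/m_k)$ and $\psi_n(x)=\prod_{k\ge0}r_k(x)^{n_k}$. Functions are complex valued. $C(G_{\mathbf m}^2)$ is the space of continuous functions with the supremum norm $\|\cdot\|_C$; $\|f\|_1=\int_{G_{\mathbf m}^2}|f|\,d\mu$.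 Fourier coefficients: $\widehat f(i,j)=\int_{G_{\mathbf m}^2}f(x,y)\overline{\psi_i(x)}\,\overline{\psi_j(y)}\,d\mu(x,y)$. Cesàro numbers: $A_0^{\gamma}=1$, $A_n^{\gamma}=\frac{(\gamma+1)\cdots(\gamma+n)}{n!}$. Cesàro means: $$\sigma_{n,m}^{-\alpha,-\beta}(x,y,f)=\frac1{A_n^{-\alpha}A_m^{-\beta}}\sum_{i=0}^n\sum_{j=0}^mA_{n-i}^{-\alpha}A_{m-j}^{-\beta}\widehat f(i,j)\psi_i(x)\psi_j(y),$$ and $\sigma_{n,m}^{-\alpha,-\beta}(f)$ is this function of $(x,y)$. Total modulus of continuity: $\omega(f,1/M_n)_C=\sup_{(u,v)\in I_n\times I_n}\|f(\cdot-u,\cdot-v)-f(\cdot,\cdot)\|_C$. *)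

(* Defs.v *)
From HB Require Import structures.
From mathcomp Require Import all_boot all_order all_algebra.
From mathcomp Require Import all_classical all_reals all_analysis.
From mathcomp Require Export complex.

Set Implicit Arguments.
Unset Strict Implicit.
Unset Printing Implicit Defensive.

Import Order.TTheory GRing.Theory Num.Theory.
Import numFieldNormedType.Exports.

Local Open Scope classical_set_scope.
Local Open Scope ring_scope.
Local Open Scope complex_scope.

(* 'Z_p is Z/pZ only for p >= 2: everything below is meant for sequences m with
   m k >= 2 for all k. *)
Definition vilenkin (m : nat -> nat) : Type :=
  prod_topology (fun k => discrete_topology 'Z_(m k)).

HB.instance Definition _ (m : nat -> nat) := Topological.on (vilenkin m).
HB.instance Definition _ (m : nat -> nat) :=
  isPointed.Build (vilenkin m) (fun k => 0 : 'Z_(m k)).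

Section VilenkinGroup.
Variable m : nat -> nat.
Implicit Types x y z : vilenkin m.

Definition vadd x y : vilenkin m := fun k => (x k : 'Z_(m k)) + y k.
Definition vopp x : vilenkin m := fun k => - (x k : 'Z_(m k)).
Definition vzero : vilenkin m := fun k => 0 : 'Z_(m k).

Lemma vaddA : associative vadd.
Proof. by move=> x y z; apply: functional_extensionality_dep => k; exact: addrA. Qed.
Lemma vaddC : commutative vadd.
Proof. by move=> x y; apply: functional_extensionality_dep => k; exact: addrC. Qed.
Lemma vadd0 : left_id vzero vadd.
Proof. by move=> x; apply: functional_extensionality_dep => k; exact: add0r. Qed.
Lemma vaddN : left_inverse vzero vopp vadd.
Proof. by move=> x; apply: functional_extensionality_dep => k; exact: addNr. Qed.

HB.instance Definition _ :=
  GRing.isZmodule.Build (vilenkin m) vaddA vaddC vadd0 vaddN.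

Definition cylinder (n : nat) : set (vilenkin m) :=
  [set x | forall k, (k < n)%N -> x k = 0 :> 'Z_(m k)].

Fixpoint M (k : nat) : nat := if k is j.+1 then (m j * M j)%N else 1%N.

Definition digit (n j : nat) : nat := (n %/ M j %% m j)%N.

End VilenkinGroup.

Definition vilenkin2 (m : nat -> nat) : Type := (vilenkin m * vilenkin m)%type.

HB.instance Definition _ (m : nat -> nat) := Pointed.on (vilenkin2 m).
HB.instance Definition _ (m : nat -> nat) := Topological.on (vilenkin2 m).
HB.instance Definition _ (m : nat -> nat) := GRing.Zmodule.on (vilenkin2 m).

Definition borel2 (m : nat -> nat) : Type :=
  g_sigma_algebraType (@open (vilenkin2 m)).

HB.instance Definition _ (m : nat -> nat) := Measurable.on (borel2 m).

Section CesaroMeans.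
Variables (R : realType) (m : nat -> nat).
Local Notation C := R[i].
Local Notation cabs := (@ComplexField.Normc.normc R).
Local Notation G := (vilenkin m).
Local Notation G2 := (vilenkin2 m).

(* Normalization is carried by the type [probability]; a translation-invariant
   Borel probability on this compact metrizable group is its unique Haar
   measure, regularity being automatic. *)
Definition normalized_haar (mu : probability (borel2 m) R) : Prop :=
  forall (w : G2) (A : set G2), measurable (A : set (borel2 m)) ->
    mu [set p + w | p in A] = mu A.

Definition rademacher (k : nat) (x : G) : C :=
  let t := 2 * pi * (x k : 'Z_(m k))%:R / (m k)%:R in cos t +i* sin t.

(* M k > k when all m k >= 2, so the digits of n of index >= n vanish and the
   infinite product may be cut at n. *)
Definition psi (n : nat) (x : G) : C :=
  \prod_(k < n) rademacher k x ^+ digit m n k.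

Section Integral.
Variable mu : probability (borel2 m) R.

Definition cintegral (f : G2 -> C) : C :=
  (\int[mu]_p complex.Re (f p)) +i* (\int[mu]_p complex.Im (f p)).

Definition norm1 (f : G2 -> C) : \bar R :=
  (\int[mu]_p (cabs (f p))%:E)%E.

Definition fourier (f : G2 -> C) (i j : nat) : C :=
  cintegral (fun p => f p * (psi i p.1)^* * (psi j p.2)^*).

Definition cesaro_number (g : R) (n : nat) : R :=
  (\prod_(1 <= j < n.+1) (g + j%:R)) / n`!%:R.

Definition cesaro_mean (g h : R) (n k : nat) (f : G2 -> C) (p : G2) : C :=
  (cesaro_number g n * cesaro_number h k)^-1%:C *
  \sum_(i < n.+1) \sum_(j < k.+1)
    (cesaro_number g (n - i) * cesaro_number h (k - j))%:C * fourier f i j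
      * psi i p.1 * psi j p.2.

End Integral.

Definition normC (f : G2 -> C) : \bar R :=
  ereal_sup [set (cabs (f p))%:E | p in setT].

(* The value omega(f, 1/M_n), indexed by n. *)
Definition total_modulus (f : G2 -> C) (n : nat) : \bar R :=
  ereal_sup [set normC (fun p => f (p - w) - f p)
            | w in cylinder n `*` cylinder n].

End CesaroMeans.

(* Main.v *)
(* Take f0(x,y) = sum_k M_k^-(alpha+beta) psi_{M_k}(x) psi_{M_k}(y).  The k-th
   term is invariant under translations by I_n x I_n as soon as k < n, so the
   modulus of continuity is controlled by the tail of the series, which is
   geometric since M_{k+1} >= 2 M_k.  The coefficient of index (M_n, M_n) enters
   the Cesaro mean of order (M_n, M_n) with the weight
   1 / (A_{M_n}^{-alpha} A_{M_n}^{-beta}) >= M_n^(alpha+beta), because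
   A_0^{-alpha} = A_0^{-beta} = 1; hence the same coefficient of
   sigma f0 - f0 is at least 1 - M_n^-(alpha+beta), and it is a lower bound for
   the L^1 norm.  Orthogonality comes from invariance of the measure: translating
   one variable by the n-th unit vector multiplies psi_{M_n} by a root of unity
   different from 1 and fixes psi_i for i < M_n and psi_{M_k} for k <> n. *)
Require Import Defs.
From mathcomp Require Import all_boot all_order all_algebra.
From mathcomp Require Import all_classical all_reals all_analysis.
From mathcomp Require Import measurable_realfun.
From mathcomp Require Import ring lra.

Set Implicit Arguments.
Unset Strict Implicit.
Unset Printing Implicit Defensive.

Import Order.TTheory GRing.Theory Num.Theory.
Import numFieldNormedType.Exports.

Local Open Scope classical_set_scope.
Local Open Scope ring_scope.
Local Open Scope complex_scope.

(** * Topology of the group: cylinders as neighbourhoods, continuity and measurability of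
    translations *)

Section Topology.
Variable m : nat -> nat.
Implicit Types (x y : vilenkin m) (p q w : vilenkin2 m).

Lemma near_coord x k : \forall y \near x, y k = x k.
Proof.
exact: (@proj_continuous nat (fun k => discrete_topology 'Z_(m k)) k x [set x k]).
Qed.

Lemma near_cylinder x n : \forall y \near x, cylinder n (x - y).
Proof.
elim: n => [|n IHn]; first by near=> y => k.
near=> y.
have yn : y n = x n.
  by near: y; exact: near_coord.
have IHy : cylinder n (x - y).
  by near: y; exact: IHn.
move=> k; rewrite ltnS leq_eqVlt => /predU1P[->|]; last exact: IHy.
by have -> : (x - y) n = (x n : 'Z_(m n)) - y n by []; rewrite yn subrr.
Unshelve. all: by end_near. Qed.

Lemma near_cylinder2 p n : \forall q \near p, (cylinder n `*` cylinder n) (p - q).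
Proof.
by exists ([set y | cylinder n (p.1 - y)], [set y | cylinder n (p.2 - y)]);
  [split; exact: near_cylinder | move=> q [q1 q2]; split].
Qed.

Lemma vadd_continuous y : continuous (fun x => x + y : vilenkin m).
Proof.
move=> x.
have FF : Filter ((fun x : vilenkin m => x + y) @ x).
  by apply: fmap_filter; exact: nbhs_filter.
(* The product topology is the supremum of the topologies induced by the coordinates, so convergence
   is tested one coordinate at a time, where the factors are discrete. *)
apply/(@cvg_sup (forall k, discrete_topology 'Z_(m k)) nat (fun i => Topological.class
    (initial_topology (fun f : (forall k, discrete_topology 'Z_(m k)) => f i))) _ _ FF) => k.
move=> A [_ [[B _ <-] Bx] sBA].
apply: (@filterS _ (nbhs x) _ _ _ _ (near_coord x k)) => t tx; apply: sBA.
by move: Bx; rewrite /= /GRing.add /= /vadd tx.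
Qed.

Lemma vadd2_continuous w : continuous (fun p => p + w : vilenkin2 m).
Proof.
move=> p A [[P Q] /= [nP nQ] sPQA].
exists ([set x | P (x + w.1)], [set y | Q (y + w.2)]); first by
  split; [exact: (@vadd_continuous w.1 p.1 P nP)
         | exact: (@vadd_continuous w.2 p.2 Q nQ)].
by move=> q [Pq Qq]; apply: sPQA.
Qed.

Lemma vadd2_measurable w :
  measurable_fun setT (fun p : borel2 m => ((p : vilenkin2 m) + w : vilenkin2 m) : borel2 m).
Proof.
apply: (@measurability _ _ (borel2 m) (borel2 m) setT _ (@open (vilenkin2 m))) => // _ [A oA <-].
rewrite setTI; apply: sub_sigma_algebra.
by move/continuousP : (@vadd2_continuous w); apply.
Qed.

End Topology.

(** * Translation invariance of real integrals *)

Section Haar.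
Variables (R : realType) (m : nat -> nat).
Variables (mu : probability (borel2 m) R) (mu_haar : normalized_haar mu).

Lemma bounded_integrable (f : borel2 m -> R) (K : R) :
  measurable_fun setT f -> (forall p, `|f p| <= K) ->
  mu.-integrable setT (EFin \o f).
Proof.
move=> mf fK; apply: measurable_bounded_integrable => //.
  exact: le_lt_trans (probability_le1 mu measurableT) (ltry _).
exists K; split; first exact: num_real.
by move=> r Kr p _; apply: le_trans (fK p) (ltW Kr).
Qed.

Lemma haar_Rintegral (w : vilenkin2 m) (f : borel2 m -> R) (K : R) :
  measurable_fun setT f -> (forall p, `|f p| <= K) ->
  \int[mu]_p f ((p : vilenkin2 m) + w : vilenkin2 m) = \int[mu]_p f p.
Proof.
move=> mf fK; rewrite /Rintegral; congr fine.
set tau := fun p : borel2 m => ((p : vilenkin2 m) + w : vilenkin2 m) : borel2 m.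
have mtau : measurable_fun setT tau by exact: vadd2_measurable.
transitivity (\int[pushforward mu tau]_p (f p)%:E)%E; last first.
  apply: eq_measure_integral => A mA _.
  (* Invariance of the measure speaks of direct images: the preimage of [A] under translation by [w]
     is its image under translation by [- w]. *)
  apply: etrans (mu_haar (- w) mA); rewrite /pushforward; congr (mu _).
  apply/seteqP; split => [q Aq|_ [q Aq <-]]; last by rewrite /= /tau addrNK.
  by exists (q + w) => //; rewrite addrK.
rewrite (integral_pushforward mtau) //; first exact/measurable_EFinP.
apply: (@bounded_integrable (f \o tau) K) => [|p].
  exact: (measurableT_comp mf mtau).
exact: fK.
Qed.

End Haar.

(** * Bounded measurable complex functions and their integrals *)

Section BoundedMeasurable.
Variables (R : realType) (m : nat -> nat).
Local Notation C := R[i].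
Local Notation cabs := (@ComplexField.Normc.normc R).
Local Notation G2 := (vilenkin2 m).
Implicit Types (f g : G2 -> C).

Lemma cabsD (z w : C) : cabs (z + w) <= cabs z + cabs w.
Proof. exact: le_normcD. Qed.

Lemma cabsN (z : C) : cabs (- z) = cabs z.
Proof. exact: normcN. Qed.

Lemma cabsJ (z : C) : cabs z^* = cabs z.
Proof. by case: z => a b /=; rewrite sqrrN. Qed.

Lemma cabs_ge0 (z : C) : 0 <= cabs z.
Proof. by case: z => a b; exact: sqrtr_ge0. Qed.

Lemma cabs_real (r : R) : cabs r%:C = `|r|.
Proof. by rewrite /= expr0n /= addr0 sqrtr_sqr. Qed.

Lemma Re_le_cabs (z : C) : `|complex.Re z| <= cabs z.
Proof. by case: z => a b /=; rewrite -sqrtr_sqr ler_wsqrtr// lerDl sqr_ge0. Qed.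

Lemma Im_le_cabs (z : C) : `|complex.Im z| <= cabs z.
Proof. by case: z => a b /=; rewrite -sqrtr_sqr ler_wsqrtr// lerDr sqr_ge0. Qed.

(** The working class for integration: for a probability measure, boundedness makes both components
    integrable, and sums, products and conjugates stay in the class. *)
Definition bmeas f :=
  [/\ measurable_fun setT (fun p : borel2 m => complex.Re (f p)),
      measurable_fun setT (fun p : borel2 m => complex.Im (f p))
    & exists K, forall p, cabs (f p) <= K].

Lemma bmeas_cst (c : C) : bmeas (fun=> c).
Proof. by split => //; exists (cabs c). Qed.

Lemma bmeasD f g : bmeas f -> bmeas g -> bmeas (fun p => f p + g p).
Proof.
move=> [mf1 mf2 [K fK]] [mg1 mg2 [L gL]]; split.
- by under eq_fun do rewrite raddfD; exact: measurable_funD.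
- by under eq_fun do rewrite raddfD; exact: measurable_funD.
- by exists (K + L) => p; apply: le_trans (cabsD _ _) (lerD (fK p) (gL p)).
Qed.

Lemma bmeasM f g : bmeas f -> bmeas g -> bmeas (fun p => f p * g p).
Proof.
move=> [mf1 mf2 [K fK]] [mg1 mg2 [L gL]]; split.
- rewrite (_ : (fun p => _) = (fun p => complex.Re (f p) * complex.Re (g p)
      - complex.Im (f p) * complex.Im (g p))).
    by apply: measurable_funB; exact: measurable_funM.
  by apply/funext => p; case: (f p); case: (g p).
- rewrite (_ : (fun p => _) = (fun p => complex.Re (f p) * complex.Im (g p)
      + complex.Im (f p) * complex.Re (g p))).
    by apply: measurable_funD; exact: measurable_funM.
  by apply/funext => p; case: (f p); case: (g p).
- exists (K * L) => p; rewrite ComplexField.Normc.normcM.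
  by apply: ler_pM; rewrite ?cabs_ge0.
Qed.

Lemma bmeasJ f : bmeas f -> bmeas (fun p => (f p)^*).
Proof.
move=> [mf1 mf2 [K fK]]; split.
- by rewrite (_ : (fun p => _) = (fun p => complex.Re (f p)))//;
    apply/funext => p; case: (f p).
- rewrite (_ : (fun p => _) = (fun p => - complex.Im (f p))).
    exact: measurableT_comp.
  by apply/funext => p; case: (f p).
- by exists K => p; rewrite cabsJ.
Qed.

Lemma bmeasB f g : bmeas f -> bmeas g -> bmeas (fun p => f p - g p).
Proof.
move=> bf bg; under eq_fun do rewrite -mulN1r.
by apply: bmeasD => //; apply: bmeasM => //; exact: bmeas_cst.
Qed.

Lemma bmeas_sum (I : Type) (r : seq I) (F : I -> G2 -> C) :
  (forall i, bmeas (F i)) -> bmeas (fun p => \sum_(i <- r) F i p).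
Proof.
move=> bF; elim: r => [|i r IHr].
  by under eq_fun do rewrite big_nil; exact: bmeas_cst.
by under eq_fun do rewrite big_cons; exact: bmeasD.
Qed.

(** Such a function is constant on the cosets of I_n x I_n, which are neighbourhoods of their
    points; the preimage of any set is therefore open, even after composition with an arbitrary
    [h]. *)
Lemma bmeas_locally_constant (n : nat) f :
    (forall p w, (cylinder n `*` cylinder n) w -> f (p - w) = f p) ->
    (exists K, forall p, cabs (f p) <= K) -> bmeas f.
Proof.
move=> fn bf; suff mf (h : C -> R) : measurable_fun setT (fun p : borel2 m => h (f p)).
  by split => //; exact: mf.
move=> _ Y _; rewrite setTI; apply: sub_sigma_algebra.
suff : open [set p : G2 | Y (h (f p))] by [].
rewrite openE => p Yp; apply: filterS (near_cylinder2 p n) => q pq.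
by rewrite /= -(subKr p q) fn.
Qed.

Section Integral.
Variables (mu : probability (borel2 m) R) (mu_haar : normalized_haar mu).
Local Notation integral := (cintegral mu).

Lemma integrable_Re f : bmeas f ->
  mu.-integrable setT (EFin \o (fun p : borel2 m => complex.Re (f p))).
Proof.
move=> [mf _ [K fK]]; apply: (@bounded_integrable _ _ _ _ K mf) => p.
exact: le_trans (Re_le_cabs _) (fK p).
Qed.

Lemma integrable_Im f : bmeas f ->
  mu.-integrable setT (EFin \o (fun p : borel2 m => complex.Im (f p))).
Proof.
move=> [_ mf [K fK]]; apply: (@bounded_integrable _ _ _ _ K mf) => p.
exact: le_trans (Im_le_cabs _) (fK p).
Qed.

Lemma cintegralD f g : bmeas f -> bmeas g ->
  integral (fun p => f p + g p) = integral f + integral g.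
Proof.
move=> bf bg; rewrite /cintegral; apply/eqP; rewrite eq_complex /=.
under eq_Rintegral do rewrite raddfD /=.
under [X in _ && (X == _)]eq_Rintegral do rewrite raddfD /=.
by rewrite !RintegralD ?eqxx//; (exact: integrable_Re || exact: integrable_Im).
Qed.

Lemma cintegralZl (c : C) f : bmeas f ->
  integral (fun p => c * f p) = c * integral f.
Proof.
move=> bf; case: c => a b; rewrite /cintegral; apply/eqP; rewrite eq_complex /=.
have [iR iI] := (integrable_Re bf, integrable_Im bf).
have iZ (r : R) h : mu.-integrable setT (EFin \o h) ->
    mu.-integrable setT (EFin \o (fun p => r * h p)) by exact: integrableZl.
rewrite -!RintegralZl// -RintegralB// ?iZ// -RintegralD// ?iZ//.
by apply/andP; split; apply/eqP/eq_Rintegral => p _; case: (f p).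
Qed.

Lemma cintegral_cst (c : C) : integral (fun=> c) = c.
Proof.
have mu1 : fine (mu setT) = 1 by rewrite probability_setT.
by case: c => a b; rewrite /cintegral /= !Rintegral_cst// mu1 !mulr1.
Qed.

Lemma haar_cintegral (w : G2) f : bmeas f ->
  integral (fun p => f (p + w)) = integral f.
Proof.
move=> [mR mI [K fK]]; congr (_ +i* _).
  apply: (haar_Rintegral mu_haar w mR (K := K)) => p.
  exact: le_trans (Re_le_cabs _) (fK p).
apply: (haar_Rintegral mu_haar w mI (K := K)) => p.
exact: le_trans (Im_le_cabs _) (fK p).
Qed.

(** Invariance gives I = z I for the integral I, so (1 - z) I = 0. All orthogonality relations below
    come from this. *)
Lemma haar_cintegral_eigen (w : G2) (z : C) f : bmeas f -> z != 1 ->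
  (forall p, f (p + w) = z * f p) -> integral f = 0.
Proof.
move=> bf z1 fw; apply/eqP.
have /eqP : integral f = z * integral f.
  by rewrite -[LHS](haar_cintegral w bf) -cintegralZl//; congr integral; exact/funext.
rewrite -subr_eq0 -[X in X - _]mul1r -mulrBl mulf_eq0 subr_eq0 eq_sym.
by rewrite (negbTE z1).
Qed.

(** The real part is enough for the lower bound sought, since the coefficient to which it is applied
    is real. *)
Lemma cintegral_le_norm1 f : bmeas f ->
  ((complex.Re (integral f))%:E <= norm1 mu f)%E.
Proof.
move=> bf; have [mR mI _] := bf.
apply: (@le_trans _ _ (\int[mu]_p `|(complex.Re (f p))%:E|))%E.
  apply: le_trans (le_abse_integral mu measurableT _); last exact/measurable_EFinP.
  by rewrite -EFin_normr_Rintegral//; [rewrite lee_fin ler_norm|exact: integrable_Re].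
apply: ge0_le_integral => //.
- by apply: measurableT_comp => //; exact/measurable_EFinP.
- apply/measurable_EFinP.
  (* Measurability of the modulus is read off from its expression as a continuous function of a sum
     of two squares. *)
  rewrite (_ : (fun p => _) = Num.sqrt \o
     (fun p => complex.Re (f p) ^+ 2 + complex.Im (f p) ^+ 2)).
    apply: measurableT_comp.
      by apply: continuous_measurable_fun => x; exact: sqrt_continuous.
    by apply: measurable_funD; exact: measurable_funX.
  by apply/funext => p /=; case: (f p).
- by move=> p _; rewrite lee_fin Re_le_cabs.
Qed.

End Integral.
End BoundedMeasurable.

(** * Digits, Vilenkin functions and their behaviour under translation *)

Section VilenkinSystem.
Variables (R : realType) (m : nat -> nat) (m_ge2 : forall k, (2 <= m k)%N).
Local Notation C := R[i].
Local Notation cabs := (@ComplexField.Normc.normc R).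
Implicit Types (x u : vilenkin m).

Lemma M_gt0 k : (0 < M m k)%N.
Proof. by elim: k => //= k IHk; rewrite muln_gt0 IHk andbT; exact: ltnW. Qed.

Lemma leq_M k : (2 ^ k <= M m k)%N.
Proof. by elim: k => //= k IHk; rewrite expnS leq_mul. Qed.

Lemma ltn_M k : (k < M m k)%N.
Proof. exact: leq_trans (ltn_expl _ _) (leq_M k). Qed.

Lemma M_addn j k : exists d, M m (j + k) = (d * M m j)%N.
Proof.
elim: k => [|k [d IHk]]; first by exists 1%N; rewrite addn0 mul1n.
by exists (m (j + k) * d)%N; rewrite addnS /= IHk mulnA.
Qed.

Lemma digit_small i N : (i < M m N)%N -> digit m i N = 0%N.
Proof. by move=> iN; rewrite /digit divn_small ?mod0n. Qed.

(** For k < j the number M_k is smaller than M_j; for j < k the quotient M_k / M_j is a multiple of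
    m_j. *)
Lemma digit_M j k : digit m (M m k) j = (k == j).
Proof.
have [kj|jk|<-] := ltngtP k j.
- apply: digit_small; rewrite -(subnKC kj).
  have [d dE] := M_addn k.+1 (j - k.+1); rewrite dE /= mulnA ltn_Pmull ?M_gt0//.
  have : (0 < M m (k.+1 + (j - k.+1)))%N by exact: M_gt0.
  rewrite dE muln_gt0 => /andP[d0 _].
  by apply: leq_trans (m_ge2 k) _; rewrite leq_pmull.
- rewrite -(subnKC jk); have [d ->] := M_addn j.+1 (k - j.+1).
  by rewrite /digit /= mulnA mulnK ?M_gt0// modnMl.
- by rewrite /digit divnn M_gt0 modn_small.
Qed.

Lemma cabs_rademacher k x : cabs (rademacher R k x) = 1.
Proof. by rewrite /rademacher /= cos2Dsin2 sqrtr1. Qed.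

Lemma cabs_psi n x : cabs (psi R n x) = 1.
Proof.
rewrite /psi; elim/big_ind : _ => [|z w z1 w1|k _].
- exact: ComplexField.Normc.normc1.
- by rewrite ComplexField.Normc.normcM z1 w1 mulr1.
- elim: (digit m n k) => [|d IHd]; first exact: ComplexField.Normc.normc1.
  by rewrite exprS ComplexField.Normc.normcM IHd mulr1 cabs_rademacher.
Qed.

(** A vanishing digit contributes the factor r_k^0 = 1, so the corresponding coordinate is not
    seen. *)
Lemma eq_psi n x y :
  (forall k, (k < n)%N -> digit m n k != 0%N -> x k = y k) -> psi R n x = psi R n y.
Proof.
move=> xy; apply: eq_bigr => k _.
have [->|nk] := eqVneq (digit m n k) 0%N; first by rewrite !expr0.
by rewrite /rademacher (xy k (ltn_ord k) nk).
Qed.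

Lemma psi_cylinder n i x u : (i <= n)%N -> cylinder n u -> psi R i (x - u) = psi R i x.
Proof.
move=> le_in un; apply: eq_psi => k ki _.
have -> : (x - u) k = (x k : 'Z_(m k)) - u k by [].
by rewrite un ?subr0//; exact: leq_trans le_in.
Qed.

Lemma psi_M k x : psi R (M m k) x = rademacher R k x.
Proof.
rewrite /psi (bigD1 (Ordinal (ltn_M k)))//= digit_M eqxx expr1.
rewrite big1 ?mulr1// => j /negbTE jk; rewrite digit_M.
by rewrite (_ : (k == j) = false) ?expr0// -jk eq_sym.
Qed.

(** Since psi_{M_k} = r_k sees coordinate k only, the level k + 1 suffices, whereas [psi_cylinder]
    would ask for level M_k. This gives the partial sums of n terms their invariance under I_n x
    I_n. *)
Lemma psi_M_cylinder n k x u :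
  (k < n)%N -> cylinder n u -> psi R (M m k) (x - u) = psi R (M m k) x.
Proof.
move=> kn un; rewrite !psi_M /rademacher.
have -> : (x - u) k = (x k : 'Z_(m k)) - u k by [].
by rewrite un ?subr0.
Qed.

Definition unitv (N : nat) : vilenkin m := fun k => (k == N)%:R : 'Z_(m k).

Lemma psi_unitv N n x : digit m n N = 0%N -> psi R n (x + unitv N) = psi R n x.
Proof.
move=> nN; apply: eq_psi => k _ nk.
have -> : (x + unitv N) k = (x k : 'Z_(m k)) + (k == N)%:R by [].
have -> : (k == N) = false by apply: contraNF nk => /eqP ->; rewrite nN.
by rewrite addr0.
Qed.

Definition zeta (N : nat) : C :=
  cos (2 * pi / (m N)%:R) +i* sin (2 * pi / (m N)%:R).

Lemma psi_M_unitv N x : psi R (M m N) (x + unitv N) = zeta N * psi R (M m N) x.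
Proof.
(* The modulus built into ['Z_(m N)] agrees with m_N because m_N >= 2. *)
have mE : (Zp_trunc (m N)).+2 = m N by exact: Zp_cast.
have mN0 : (m N)%:R != 0 :> R by rewrite pnatr_eq0 -lt0n; exact: ltnW.
rewrite !psi_M /rademacher.
have -> : (x + unitv N) N = (x N : 'Z_(m N)) + 1 by rewrite {1}/GRing.add /= /vadd /unitv eqxx.
set a : 'Z_(m N) := x N; set t : R := 2 * pi * a%:R / (m N)%:R.
set s : R := 2 * pi / (m N)%:R.
transitivity (cos (t + s) +i* sin (t + s)); last first.
  by rewrite addrC cosD sinD; apply/eqP; rewrite eq_complex /= eqxx addrC eqxx.
have tsE : t + s = 2 * pi * (a.+1)%:R / (m N)%:R.
  by rewrite /t /s -mulrDl -[a.+1%:R]natr1 [in RHS]mulrDr mulr1.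
have aE : nat_of_ord (a + 1)%R = (a.+1 %% m N)%N.
  by rewrite /= modnDmr addn1; congr (_ %% _)%N; exact: mE.
rewrite aE; have : (a.+1 <= m N)%N by apply: leq_trans (ltn_ord a) _; rewrite mE.
(* Either the coordinate increases by one, or it wraps around from m_N - 1 to 0 while the angle
   completes a full turn. *)
rewrite leq_eqVlt => /predU1P[am|am]; last by rewrite modn_small// tsE.
rewrite tsE am modnn mulr0 mul0r mulfK// cos0 sin0.
by rewrite mulr_natl cos2pi sin2pi.
Qed.

Lemma zeta_neq1 N : zeta N != 1.
Proof.
have mN : 2 <= (m N)%:R :> R by rewrite ler_nat.
have pi0 := pi_gt0 R.
have s0 : 0 < 2 * pi / (m N)%:R :> R by rewrite divr_gt0 ?mulr_gt0//; exact: lt_le_trans mN.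
have spi : 2 * pi / (m N)%:R <= pi :> R.
  by rewrite ler_pdivrMr ?(lt_le_trans _ mN)// mulrC ler_wpM2l// ltW.
apply/eqP => /(congr1 (@complex.Re R)) /= /esym.
(* As m_N >= 2, the angle lies in (0, pi], and the cosine is injective on [0, pi]. *)
rewrite -[X in X = _]cos0 => /cos_inj.
rewrite !in_itv /= lexx spi (ltW s0) (ltW pi0) => /(_ isT isT) s00.
by move: s0; rewrite -s00 ltxx.
Qed.

End VilenkinSystem.

(** * Upper bound for Cesaro numbers of negative order *)

Section CesaroNumbers.
Variables (R : realType) (alpha : R) (alpha01 : 0 < alpha < 1).

Lemma cesaro_numberS (g : R) n :
  cesaro_number g n.+1 = cesaro_number g n * (1 + g / n.+1%:R).
Proof.
rewrite /cesaro_number big_nat_recr//= factS mulnC natrM invfM.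
have n0 : n.+1%:R != 0 :> R by rewrite pnatr_eq0.
by rewrite mulrACA; congr (_ * _); rewrite mulrDl divff// addrC.
Qed.

Lemma cesaro_number0 (g : R) : cesaro_number g 0 = 1.
Proof. by rewrite /cesaro_number big_geq// fact0 divr1. Qed.

Lemma cesaro_number_gt0 n : 0 < cesaro_number (- alpha) n.
Proof.
have /andP[a0 a1] := alpha01.
elim: n => [|n IHn]; first by rewrite cesaro_number0.
rewrite cesaro_numberS mulr_gt0// mulNr subr_gt0 ltr_pdivrMr// mul1r.
by apply: lt_le_trans a1 _; rewrite ler1n.
Qed.

(** Induction with s = 1/(n+1): the recurrence multiplies by 1 - alpha s, the right side by (1 +
    s)^(-alpha), and 1 - alpha s <= exp(-alpha s) <= exp(-alpha ln(1 + s)). The constant is exactly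
    1, so no loss enters the final estimate. *)
Lemma cesaro_number_le_powR n :
  cesaro_number (- alpha) n <= n.+1%:R^-1 `^ alpha.
Proof.
have /andP[a0 a1] := alpha01.
elim: n => [|n IHn]; first by rewrite cesaro_number0 invr1 powR1.
rewrite cesaro_numberS.
set s : R := n.+1%:R^-1.
have s0 : 0 < s by rewrite invr_gt0.
have -> : n.+2%:R^-1 = s * (1 + s)^-1 :> R.
  have t0 : 0 < n.+1%:R :> R by [].
  rewrite /s -[n.+2%:R]natr1; move: n.+1%:R t0 => t t0; field.
  by apply/andP; split; apply: lt0r_neq0; lra.
rewrite powRM; [|by rewrite ltW|by rewrite invr_ge0; lra].
apply: ler_pM => //; [exact/ltW/cesaro_number_gt0| |].
  have : s <= 1 by rewrite invf_le1// ler1n.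
  nra.
rewrite /powR gt_eqF ?invr_gt0; last lra.
rewrite lnV ?posrE; last lra.
apply: le_trans (expR_ge1Dx _) _; rewrite ler_expR.
by rewrite mulrN mulNr lerN2 ler_pM2l// le_ln1Dx//; lra.
Qed.

End CesaroNumbers.

(** * Series dominated by a geometrically decreasing sequence *)

Section GeometricSeries.
Variables (R : realType) (q : R) (a : nat -> R).
Hypotheses (q1 : q < 1) (a_ge0 : forall k, 0 <= a k)
  (aS : forall k, a k.+1 <= q * a k).

(** From [aS] one gets (1 - q) a_k <= a_k - a_{k+1}, and the right sides telescope. *)
Lemma geometric_tail (u : nat -> R) n d : (forall k, `|u k| <= a k) ->
  \sum_(n <= k < n + d) `|u k| <= (a n - a (n + d)%N) / (1 - q).
Proof.
move=> ua; have q0 : 0 < 1 - q by rewrite subr_gt0.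
elim: d => [|d IHd]; first by rewrite addn0 big_geq// subrr mul0r.
rewrite addnS big_nat_recr ?leq_addr//=.
apply: le_trans (lerD IHd (ua _)) _.
rewrite -lerBrDl -mulrBl ler_pdivlMr//.
by have := aS (n + d); lra.
Qed.

Lemma real_series_tail (u : nat -> R) : (forall k, `|u k| <= a k) ->
  exists l, forall n, `|l - \sum_(0 <= k < n) u k| <= a n / (1 - q).
Proof.
move=> ua; have q0 : 0 < 1 - q by rewrite subr_gt0.
have tail n d : \sum_(n <= k < n + d) `|u k| <= a n / (1 - q).
  apply: le_trans (geometric_tail _ _ ua) _.
  by rewrite ler_pM2r ?invr_gt0// gerBl.
have cu : cvgn (series u).
  apply: normed_cvg; apply: nondecreasing_is_cvgn.
    by apply: nondecreasing_series => k _ _ /=.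
  by exists (a 0%N / (1 - q)) => _ [n _ <-]; exact: (tail 0%N n).
exists (limn (series u)) => n.
(* The block estimate is uniform in the length of the block, so it passes to the limit. *)
have cB : `|series u k - \sum_(0 <= k < n) u k| @[k --> \oo] -->
    `|limn (series u) - \sum_(0 <= k < n) u k|.
  by apply: cvg_norm; apply: cvgB => //; exact: cvg_cst.
apply: (cvgr_to_le cB); exists n => // k /= nk.
rewrite seriesEnat /= (big_cat_nat (leq0n n) nk)//= addrAC subrr add0r.
apply: le_trans (ler_norm_sum _ _ _) _.
by rewrite -(subnKC nk).
Qed.

(** Real and imaginary parts are summed separately; each has error at most a_n / (1 - q), whence the
    factor 2. *)
Lemma complex_series_tail (c : nat -> R[i]) :
    (forall k, ComplexField.Normc.normc (c k) <= a k) ->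
  exists l, forall n,
    ComplexField.Normc.normc (l - \sum_(k < n) c k) <= 2 / (1 - q) * a n.
Proof.
move=> ca.
have [x xP] := real_series_tail (fun k => le_trans (Re_le_cabs _) (ca k)).
have [y yP] := real_series_tail (fun k => le_trans (Im_le_cabs _) (ca k)).
exists (x +i* y) => n; set S := \sum_(k < n) c k.
have -> : x +i* y - S = (x - complex.Re S)%:C + 'i * (y - complex.Im S)%:C.
  by case: S => b d; simpc.
apply: le_trans (cabsD _ _) _.
rewrite ComplexField.Normc.normcM !cabs_real.
have -> : ComplexField.Normc.normc ('i : R[i]) = 1.
  by rewrite /= expr0n expr1n add0r sqrtr1.
have -> : complex.Re S = \sum_(k < n) complex.Re (c k) by exact: raddf_sum.
have -> : complex.Im S = \sum_(k < n) complex.Im (c k) by exact: raddf_sum.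
rewrite mul1r.
have := lerD (xP n) (yP n); rewrite !big_mkord. move=> /le_trans; apply.
by rewrite [leRHS](_ : _ = a n / (1 - q) + a n / (1 - q))//; ring.
Qed.

End GeometricSeries.

(** * The weights M_k^(-gamma) and their geometric decay *)

Section Lacunary.
Variables (R : realType) (m : nat -> nat) (m_ge2 : forall k, (2 <= m k)%N).
Variables (gamma : R) (gamma_gt0 : 0 < gamma).

Definition weight k : R := (M m k)%:R^-1 `^ gamma.
(** Bound for the ratio of successive weights, coming from M_{k+1} >= 2 M_k. *)
Definition decay : R := 2^-1 `^ gamma.

Lemma decay_ge0 : 0 <= decay. Proof. exact: powR_ge0. Qed.

Lemma decay_lt1 : decay < 1.
Proof.
have : 2^-1 < 1 :> R by rewrite invf_lt1// ltr1n.
by move/(gt0_ltr_powR gamma_gt0); rewrite powR1 !nnegrE; apply.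
Qed.

Lemma weight_ge0 k : 0 <= weight k. Proof. exact: powR_ge0. Qed.

Lemma weightS k : weight k.+1 <= decay * weight k.
Proof.
rewrite /weight /decay -powRM ?invr_ge0// ge0_ler_powR ?nnegrE ?invr_ge0//.
- exact: ltW.
- rewrite /= natrM invfM ler_wpM2r ?invr_ge0//.
  by rewrite lef_pV2 ?posrE ?ltr0n// ?ler_nat// ltnW.
Qed.

Lemma weight_le_exp k : weight k <= decay ^+ k.
Proof.
elim: k => [|k IHk]; first by rewrite /weight /= invr1 powR1 expr0.
by rewrite exprS (le_trans (weightS k))// ler_wpM2l// decay_ge0.
Qed.

Lemma weight_cvg0 : weight k @[k --> \oo] --> 0.
Proof.
apply: (@squeeze_cvgr _ _ _ _ (fun=> 0) (fun k => decay ^+ k)).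
- by apply: nearW => k; rewrite weight_ge0 weight_le_exp.
- exact: cvg_cst.
- by apply: cvg_expr; rewrite ger0_norm ?decay_ge0// decay_lt1.
Qed.

End Lacunary.

(** * Fourier coefficients, orthogonality, and the corner coefficient of a Cesaro mean *)

Section Fourier.
Variables (R : realType) (m : nat -> nat) (m_ge2 : forall k, (2 <= m k)%N).
Variables (mu : probability (borel2 m) R) (mu_haar : normalized_haar mu).
Local Notation C := R[i].
Local Notation cabs := (@ComplexField.Normc.normc R).
Local Notation G2 := (vilenkin2 m).
Implicit Types (f g : G2 -> C).

Lemma bmeas_psi1 i : bmeas (fun p : G2 => psi R i p.1).
Proof.
apply: (@bmeas_locally_constant R m i) => [p w [w1 _]|].
  exact: psi_cylinder (leqnn i) w1.
by exists 1 => p; rewrite cabs_psi.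
Qed.

Lemma bmeas_psi2 i : bmeas (fun p : G2 => psi R i p.2).
Proof.
apply: (@bmeas_locally_constant R m i) => [p w [_ w2]|].
  exact: psi_cylinder (leqnn i) w2.
by exists 1 => p; rewrite cabs_psi.
Qed.

Lemma bmeas_fourier f i j :
  bmeas f -> bmeas (fun p => f p * (psi R i p.1)^* * (psi R j p.2)^*).
Proof.
by move=> bf; apply: bmeasM (bmeasJ (bmeas_psi2 j)); apply: bmeasM => //;
  exact: bmeasJ (bmeas_psi1 i).
Qed.

Lemma fourierD f g i j : bmeas f -> bmeas g ->
  fourier mu (fun p => f p + g p) i j = fourier mu f i j + fourier mu g i j.
Proof.
move=> bf bg; rewrite /fourier -cintegralD; try exact: bmeas_fourier.
by congr cintegral; apply/funext => p; rewrite !mulrDl.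
Qed.

Lemma fourierZl (c : C) f i j : bmeas f ->
  fourier mu (fun p => c * f p) i j = c * fourier mu f i j.
Proof.
move=> bf; rewrite /fourier -cintegralZl; last exact: bmeas_fourier.
by congr cintegral; apply/funext => p; rewrite !mulrA.
Qed.

Lemma fourierB f g i j : bmeas f -> bmeas g ->
  fourier mu (fun p => f p - g p) i j = fourier mu f i j - fourier mu g i j.
Proof.
move=> bf bg; rewrite -[X in _ - X]mul1r -mulNr -fourierZl// -fourierD//.
  by congr fourier; apply/funext => p; rewrite mulN1r.
by apply: bmeasM => //; exact: bmeas_cst.
Qed.

Lemma psi_conj i (x : vilenkin m) : psi R i x * (psi R i x)^* = 1.
Proof.
by rewrite -sqr_normc (_ : `|_| = (cabs (psi R i x))%:C)// cabs_psi expr1n.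
Qed.

Lemma fourier_character i j :
  fourier mu (fun p => psi R i p.1 * psi R j p.2) i j = 1.
Proof.
rewrite /fourier -[RHS](cintegral_cst mu); congr cintegral; apply/funext => p.
by rewrite (mulrAC (psi R i p.1)) psi_conj mul1r psi_conj.
Qed.

Lemma zetaJ_neq1 N : Num.conj (zeta R m N) != 1.
Proof.
apply: contra (zeta_neq1 R m_ge2 N); rewrite /zeta !eq_complex /=.
by rewrite oppr_eq0.
Qed.

(** Translating by [unitv m N] in the first variable fixes [f] and multiplies the conjugated
    character by the conjugate of [zeta], which differs from 1. *)
Lemma fourier_invariant1 N f : bmeas f ->
  (forall p, f (p + (unitv m N, 0) : G2) = f p) ->
  fourier mu f (M m N) (M m N) = 0.
Proof.
move=> bf fN.
apply: (haar_cintegral_eigen mu_haar (bmeas_fourier _ _ bf) (zetaJ_neq1 N)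
  (w := (unitv m N, 0))) => p.
have -> : (p + (unitv m N, 0) : G2).1 = p.1 + unitv m N by [].
have -> : (p + (unitv m N, 0) : G2).2 = p.2 by exact: addr0.
rewrite fN psi_M_unitv// rmorphM; ring.
Qed.

Lemma fourier_invariant2 N f : bmeas f ->
  (forall p, f (p + (0, unitv m N) : G2) = f p) ->
  fourier mu f (M m N) (M m N) = 0.
Proof.
move=> bf fN.
apply: (haar_cintegral_eigen mu_haar (bmeas_fourier _ _ bf) (zetaJ_neq1 N)
  (w := (0, unitv m N))) => p.
have -> : (p + (0, unitv m N) : G2).1 = p.1 by exact: addr0.
have -> : (p + (0, unitv m N) : G2).2 = p.2 + unitv m N by [].
rewrite fN psi_M_unitv// rmorphM; ring.
Qed.

Lemma fourier_le_norm1 f i j : bmeas f ->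
  ((complex.Re (fourier mu f i j))%:E <= norm1 mu f)%E.
Proof.
move=> bf; apply: le_trans (cintegral_le_norm1 mu (bmeas_fourier i j bf)) _.
rewrite /norm1 le_eqVlt; apply/orP; left; apply/eqP/eq_integral => p _.
by rewrite !ComplexField.Normc.normcM !cabsJ !cabs_psi !mulr1.
Qed.

Lemma bmeas_cesaro_mean (g h : R) n k f : bmeas (cesaro_mean mu g h n k f).
Proof.
apply: bmeasM; first exact: bmeas_cst.
apply: bmeas_sum => i; apply: bmeas_sum => j.
by apply: bmeasM (bmeas_psi2 j); apply: bmeasM (bmeas_psi1 i); exact: bmeas_cst.
Qed.

(** The index square splits into i < n, killed by translation in the first variable, the edge i = n
    with j < n, killed by translation in the second, and the corner (n, n), whose weight is A_0 A_0
    = 1. *)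
Lemma fourier_cesaro_mean (g h : R) N f :
  fourier mu (cesaro_mean mu g h (M m N) (M m N) f) (M m N) (M m N) =
  (cesaro_number g (M m N) * cesaro_number h (M m N))^-1%:C
    * fourier mu f (M m N) (M m N).
Proof.
set n := M m N; set c := fourier mu f n n.
pose T i j (p : G2) := (cesaro_number g (n - i) * cesaro_number h (n - j))%:C
  * fourier mu f i j * psi R i p.1 * psi R j p.2.
have bT i j : bmeas (T i j).
  by apply: bmeasM (bmeas_psi2 j); apply: bmeasM (bmeas_psi1 i); exact: bmeas_cst.
pose T1 p := \sum_(i < n) \sum_(j < n.+1) T i j p.
pose T2 p := \sum_(j < n) T n j p.
have bT1 : bmeas T1 by apply: bmeas_sum => i; apply: bmeas_sum => j.
have bT2 : bmeas T2 by exact: bmeas_sum.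
have T1_0 : fourier mu T1 n n = 0.
  apply: fourier_invariant1 => // p; apply: eq_bigr => i _; apply: eq_bigr => j _.
  by rewrite /T /= addr0 psi_unitv// digit_small.
have T2_0 : fourier mu T2 n n = 0.
  apply: fourier_invariant2 => // p; apply: eq_bigr => j _.
  by rewrite /T /= addr0 psi_unitv// digit_small.
have bchi : bmeas (fun p : G2 => psi R n p.1 * psi R n p.2).
  exact: bmeasM (bmeas_psi1 n) (bmeas_psi2 n).
have bcchi : bmeas (fun p : G2 => c * (psi R n p.1 * psi R n p.2)).
  exact: bmeasM (bmeas_cst _ _) _.
have -> : cesaro_mean mu g h n n f = (fun p =>
    (cesaro_number g n * cesaro_number h n)^-1%:C *
    (T1 p + (T2 p + c * (psi R n p.1 * psi R n p.2)))).
  apply/funext => p; rewrite /cesaro_mean big_ord_recr /=; congr (_ * (_ + _)).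
  rewrite big_ord_recr /=; congr (_ + _).
  by rewrite subnn !cesaro_number0 mulr1 mul1r mulrA.
rewrite fourierZl; last by do 2 apply: bmeasD => //.
rewrite fourierD//; last exact: bmeasD.
by rewrite fourierD// fourierZl// fourier_character T1_0 T2_0 !add0r mulr1.
Qed.

End Fourier.

(** * The lacunary series: existence, modulus, continuity and diagonal coefficients *)

Section LacunarySeries.
Variables (R : realType) (m : nat -> nat) (m_ge2 : forall k, (2 <= m k)%N).
Variables (gamma : R) (gamma_gt0 : 0 < gamma).
Local Notation C := R[i].
Local Notation cabs := (@ComplexField.Normc.normc R).
Local Notation G2 := (vilenkin2 m).
Local Notation weight := (weight m gamma).

Definition lacunary_term k (p : G2) : C :=
  (weight k)%:C * (psi R (M m k) p.1 * psi R (M m k) p.2).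

Definition lacunary_sum n p := \sum_(k < n) lacunary_term k p.

Lemma cabs_lacunary_term k p : cabs (lacunary_term k p) = weight k.
Proof.
rewrite /lacunary_term !ComplexField.Normc.normcM !cabs_psi !mulr1 cabs_real.
by rewrite ger0_norm ?weight_ge0.
Qed.

Lemma lacunary_sum_cylinder n p w : (cylinder n `*` cylinder n) w ->
  lacunary_sum n (p - w) = lacunary_sum n p.
Proof.
move=> [w1 w2]; apply: eq_bigr => k _; rewrite /lacunary_term.
have -> : (p - w).1 = p.1 - w.1 by [].
have -> : (p - w).2 = p.2 - w.2 by [].
by rewrite (psi_M_cylinder R m_ge2 _ (ltn_ord k) w1)
  (psi_M_cylinder R m_ge2 _ (ltn_ord k) w2).
Qed.

Lemma bmeas_lacunary_term k : bmeas (lacunary_term k).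
Proof.
by apply: bmeasM (bmeas_cst _ _) _; exact: bmeasM (bmeas_psi1 _ _ _) (bmeas_psi2 _ _ _).
Qed.

(** The sum of the series is characterised by its uniform tail estimate, from which all its
    properties are derived. *)
Definition is_lacunary (f : G2 -> C) := exists K, 0 <= K /\
  forall n p, cabs (f p - lacunary_sum n p) <= K * weight n.

Lemma lacunary_exists : exists f, is_lacunary f.
Proof.
(* The sum is chosen point by point; the estimate is uniform because the constant does not depend on
   the point. *)
have [|f fP] := @choice G2 C (fun p l => forall n,
    cabs (l - lacunary_sum n p) <= 2 / (1 - decay gamma) * weight n).
  move=> p; apply: (@complex_series_tail R (decay gamma) weight
    (decay_lt1 gamma_gt0) (weight_ge0 m gamma) (weightS m_ge2 gamma_gt0)
    (fun k => lacunary_term k p)).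
  by move=> k; rewrite cabs_lacunary_term.
exists f, (2 / (1 - decay gamma)); split => //.
by rewrite divr_ge0// subr_ge0 ltW// decay_lt1.
Qed.

Variables (f : G2 -> C) (f_lacunary : is_lacunary f).

(** The n-th partial sum cancels in the difference by invariance; two tails remain. *)
Lemma lacunary_modulus : exists2 K, 0 <= K & forall n p w,
  (cylinder n `*` cylinder n) w -> cabs (f (p - w) - f p) <= K * weight n.
Proof.
have [K [K0 fK]] := f_lacunary; exists (K + K); first exact: addr_ge0.
move=> n p w wn; rewrite mulrDl.
have -> : f (p - w) - f p = (f (p - w) - lacunary_sum n (p - w))
    + - (f p - lacunary_sum n p).
  by rewrite lacunary_sum_cylinder// opprB addrA addrNK.
by apply: le_trans (cabsD _ _) _; rewrite cabsN lerD.
Qed.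

Lemma near_weight (K e : R) : 0 < e -> \forall n \near \oo, K * weight n <= e.
Proof.
move=> e0; have Kw : K * weight n @[n --> \oo] --> 0.
  rewrite -[X in _ --> X](mulr0 K); apply: cvgM; first exact: cvg_cst.
  exact: weight_cvg0.
exact: (cvgr_le 0 Kw e e0).
Qed.

Lemma lacunary_continuous : continuous (f : G2 -> C^o).
Proof.
have [K K0 fK] := lacunary_modulus.
move=> p; apply/cvgrPdist_le => -[e e'].
(* The radius is a complex number; positivity in the order of [R[i]] forces its imaginary part to
   vanish. *)
rewrite ltcE /= => /andP[/eqP -> e0].
have [n _ nK] := near_weight K e0.
apply: filterS (near_cylinder2 p n) => q pq.
have -> : `|f p - f q| = (cabs (f p - f q))%:C by [].
rewrite lecR -cabsN opprB -{1}(subKr p q); apply: le_trans (fK n _ _ pq) _.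
exact: (nK n (leqnn n)).
Qed.

Lemma bmeas_lacunary : bmeas f.
Proof.
have [K [K0 fK]] := f_lacunary.
have bS n : bmeas (lacunary_sum n) by apply: bmeas_sum => k; exact: bmeas_lacunary_term.
split.
- apply: (@measurable_fun_cvg _ (borel2 m) R setT (fun n p => complex.Re (lacunary_sum n p))).
    by move=> n; have [] := bS n.
  move=> p _; apply/cvgrPdist_le => e e0.
  apply: filterS (near_weight K e0) => n; apply: le_trans.
  by apply: le_trans (fK n p); rewrite -raddfB; exact: Re_le_cabs.
- apply: (@measurable_fun_cvg _ (borel2 m) R setT (fun n p => complex.Im (lacunary_sum n p))).
    by move=> n; have [] := bS n.
  move=> p _; apply/cvgrPdist_le => e e0.
  apply: filterS (near_weight K e0) => n; apply: le_trans.
  by apply: le_trans (fK n p); rewrite -raddfB; exact: Im_le_cabs.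
(* At order 0 the partial sum is empty, so the tail estimate bounds [f] itself. *)
- exists (K * weight 0) => p; have := fK 0%N p.
  by rewrite /lacunary_sum big_ord0 subr0.
Qed.

(* Only the [N]-th term of the series is moved by this translation. *)
Lemma lacunary_unitv1 N p :
  f (p + (unitv m N, 0) : G2) - lacunary_term N (p + (unitv m N, 0) : G2) =
  f p - lacunary_term N p.
Proof.
have [K [K0 fK]] := f_lacunary.
set q : G2 := p + _.
have tE k : k != N -> lacunary_term k q = lacunary_term k p.
  move=> kN; rewrite /lacunary_term /q /= addr0 psi_unitv//.
  by rewrite digit_M// (negbTE kN).
apply/eqP; rewrite -subr_eq0; apply/eqP/ComplexField.Normc.eq0_normc/eqP.
rewrite eq_le cabs_ge0 andbT; apply/ler_addgt0Pr => e e0; rewrite add0r.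
have [n _ nK] := near_weight (K + K) e0.
(* The truncation order exceeds [N], so that the [N]-th term occurs in the partial sum and can be
   split off. *)
have nN : (N < maxn n N.+1)%N by rewrite leq_max leqnn orbT.
have := nK (maxn n N.+1) (leq_maxl _ _); apply: le_trans.
set l := maxn n N.+1 in nN *.
have sE r : lacunary_sum l r = lacunary_term N r
    + \sum_(k < l | k != N :> nat) lacunary_term k r.
  by rewrite /lacunary_sum (bigD1 (Ordinal nN)).
have -> : f q - lacunary_term N q - (f p - lacunary_term N p) =
    (f q - lacunary_sum l q) + - (f p - lacunary_sum l p).
  rewrite !sE (eq_bigr (fun k : 'I_l => lacunary_term k p)) => [|k /tE//].
  by ring.
by rewrite mulrDl; apply: le_trans (cabsD _ _) _; rewrite cabsN lerD.
Qed.

(** Removing the [N]-th term leaves a function invariant under [unitv m N] in the first variable,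
    hence without this coefficient. *)
Lemma fourier_lacunary (mu : probability (borel2 m) R) N :
  normalized_haar mu -> fourier mu f (M m N) (M m N) = (weight N)%:C.
Proof.
move=> mu_haar; have bf := bmeas_lacunary; have bN := bmeas_lacunary_term N.
have -> : f = fun p => (f p - lacunary_term N p) + lacunary_term N p.
  by apply/funext => p; rewrite addrNK.
rewrite fourierD//; last exact: bmeasB.
rewrite fourier_invariant1//; [|exact: bmeasB|exact: lacunary_unitv1].
rewrite add0r fourierZl ?fourier_character ?mulr1//.
exact: bmeasM (bmeas_psi1 _ _ _) (bmeas_psi2 _ _ _).
Qed.

End LacunarySeries.

(** * Lower bound for the L^1 error, and the conclusion *)

Lemma cesaro_norm1_ge (R : realType) (m : nat -> nat)
    (m_ge2 : forall k, (2 <= m k)%N)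
    (mu : probability (borel2 m) R) (mu_haar : normalized_haar mu)
    (alpha beta : R) (f : vilenkin2 m -> R[i]) (N : nat) :
  0 < alpha < 1 -> 0 < beta < 1 -> is_lacunary (alpha + beta) f -> (0 < N)%N ->
  ((1 - decay (alpha + beta))%:E <= norm1 mu (fun p =>
     cesaro_mean mu (- alpha) (- beta) (M m N) (M m N) f p - f p)%R)%E.
Proof.
move=> a01 b01 fl N0; set g := alpha + beta.
have [a0 _] := andP a01; have [b0 _] := andP b01.
have g0 : 0 < g by exact: addr_gt0.
have bf := bmeas_lacunary m_ge2 g0 fl.
have bs := bmeas_cesaro_mean mu (- alpha) (- beta) (M m N) (M m N) f.
apply: le_trans (fourier_le_norm1 mu (M m N) (M m N) (bmeasB bs bf)).
rewrite fourierB// fourier_cesaro_mean// (fourier_lacunary m_ge2 g0 fl)//.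
rewrite lee_fin -rmorphM -rmorphB /=.
set A := cesaro_number (- alpha) (M m N); set B := cesaro_number (- beta) (M m N).
have A0 : 0 < A by exact: cesaro_number_gt0.
have B0 : 0 < B by exact: cesaro_number_gt0.
have n0 : 0 < (M m N)%:R :> R by rewrite ltr0n M_gt0.
have le_powR (c : R) : 0 < c < 1 ->
    cesaro_number (- c) (M m N) <= (M m N)%:R^-1 `^ c.
  move=> c01; apply: le_trans (cesaro_number_le_powR c01 _) _.
  have [c0 _] := andP c01.
  apply: ge0_ler_powR; rewrite ?nnegrE ?invr_ge0 ?(ltW c0)//.
  by rewrite lef_pV2 ?posrE// ler_nat.
(* The weight of the series is matched to the Cesaro normalisation: dividing it by A B leaves at
   least 1. *)
have ABw : A * B <= weight m g N.
  rewrite /weight powRD; last by rewrite gt_eqF ?invr_gt0//= implybT.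
  by apply: ler_pM; [exact: ltW|exact: ltW|exact: le_powR|exact: le_powR].
have AB0 : 0 < A * B by exact: mulr_gt0.
apply: lerB; first by rewrite ler_pdivlMl// mulr1.
apply: le_trans (weight_le_exp m_ge2 g0 N) _.
(* With N >= 1 the subtracted weight is at most [decay], which makes the bound independent of N. *)
rewrite -[leRHS]expr1; apply: ler_wiXn2l => //; first exact: decay_ge0.
by rewrite ltW// decay_lt1.
Qed.

Theorem theorem2 (R : realType) (m : nat -> nat)
  (m_ge2 : forall k, (2 <= m k)%N)
  (m_bounded : exists B : nat, forall k, (m k <= B)%N)
  (mu : probability (borel2 m) R) (mu_haar : normalized_haar mu)
  (alpha beta : R)
  (alpha01 : 0 < alpha < 1) (beta01 : 0 < beta < 1)
  (alphabeta : alpha + beta < 1) :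
  exists f0 : vilenkin2 m -> R[i],
    [/\ continuous (f0 : vilenkin2 m -> R[i]^o),
        exists K : R, \forall n \near \oo,
          (total_modulus f0 n <=
             (K * (M m n)%:R^-1 `^ (alpha + beta))%:E)%E
      & (0 < limn_esup (fun n => norm1 mu (fun p =>
           cesaro_mean mu (- alpha) (- beta) (M m n) (M m n) f0 p - f0 p)%R))%E].
Proof.
have [a0 _] := andP alpha01; have [b0 _] := andP beta01.
have g0 : 0 < alpha + beta by exact: addr_gt0.
have [f fl] := lacunary_exists m_ge2 g0.
exists f; split; first exact: (lacunary_continuous m_ge2 g0 fl).
- have [K K0 fK] := lacunary_modulus m_ge2 fl.
  exists K; apply: nearW => n; apply: ge_ereal_sup => _ [w wn <-].
  by apply: ge_ereal_sup => _ [p _ <-]; rewrite lee_fin; exact: fK.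
- apply: (@lt_le_trans _ _ (1 - decay (alpha + beta))%:E).
    by rewrite lte_fin subr_gt0 decay_lt1.
  apply: le_ereal_inf_tmp => _ [V [k _ kV] <-].
  (* The upper limit is an infimum of suprema over neighbourhoods [V] of infinity; [V] contains
     every index from [k] on, and [k.+1] is one that is also positive. *)
  apply: le_trans (cesaro_norm1_ge m_ge2 mu_haar alpha01 beta01 fl (ltn0Sn k)) _.
  by apply: ereal_sup_ubound; exists k.+1 => //; apply: kV => /=.
Qed.
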